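(* Let $k\ge 2$ be an integer. Let $T_n$ and $U_n$ denote the Chebyshev polynomials of the first and second kinds, and for $\alpha,\beta\in\{0,1\}$ let $A_{1,k}^{(\alpha,\beta)}$ be the $k\times k$ matrix defined in the context. Then the following representations of characteristic polynomials hold: $$\det(zI-A_{1,k}^{(0,0)})=i^{k-1}zU_{k-1}\Big(\frac{z}{2i}\Big),$$ $$\det(zI-A_{1,k}^{(0,1)})=2i^kT_k\Big(\frac{z}{2i}\Big)-2i^{k-1}U_{k-1}\Big(\frac{z}{2i}\Big),$$ $$\det(zI-A_{1,k}^{(1,0)})=2T_k\Big(\frac{z}{2}\Big),$$ $$\det(zI-A_{1,k}^{(1,1)})=(z-2)U_{k-1}\Big(\frac{z}{2}\Big).$$
   Context: For $\alpha,\beta\in\{0,1\}$ put $c=(-1)^{\beta+1}$ and $d=(-1)^{\alpha+\beta}$. For $k\ge 2$ the $k\times k$ matrix $A_{1,k}^{(\alpha,\beta)}=(a_{m,n})_{m,n=1}^{k}$ is the tridiagonal matrix with $a_{1,1}=1$; $a_{m,m+1}=d$ for $m=1,\dots,k-1$; $a_{m,m-1}=c$ for $m=2,\dots,k$; $a_{k,k}=c$; and all other entries equal to $0$. $I$ is the unit matrix and $i$ is the imaginary unit. Chebyshev polynomials: $T_0(z)=1$, $T_1(z)=z$, $T_{n+1}(z)=2zT_n(z)-T_{n-1}(z)$; $U_0(z)=1$, $U_1(z)=2z$, $U_{n+1}(z)=2zU_n(z)-U_{n-1}(z)$. *)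

(* Defs.v *)
From HB Require Import structures.
From mathcomp Require Import all_boot all_order all_algebra.
Set Implicit Arguments.
Unset Strict Implicit.
Unset Printing Implicit Defensive.
Import Order.TTheory GRing.Theory Num.Theory.
Local Open Scope ring_scope.

Fixpoint chebT (R : comNzRingType) (n : nat) : {poly R} :=
  match n with
  | 0 => 1
  | n1.+1 => match n1 with
             | 0 => 'X
             | n2.+1 => 2%:R *: 'X * chebT R n1 - chebT R n2
             end
  end.

Fixpoint chebU (R : comNzRingType) (n : nat) : {poly R} :=
  match n with
  | 0 => 1
  | n1.+1 => match n1 with
             | 0 => 2%:R *: 'X
             | n2.+1 => 2%:R *: 'X * chebU R n1 - chebU R n2
             end
  end.

(* Rows and columns are indexed from 0, so the corners a_{1,1} = 1 and
   a_{k,k} = c sit at indices 0 and k.-1; they are distinct only if k >= 2.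
   The exponents alpha and beta are meant to range over {0, 1}. *)
Definition matA1 (R : comNzRingType) (k alpha beta : nat) : 'M[R]_k :=
  let c : R := (-1) ^+ (beta + 1) in
  let d : R := (-1) ^+ (alpha + beta) in
  \matrix_(m < k, n < k)
    if n == m.+1 :> nat then d
    else if m == n.+1 :> nat then c
    else if (m == 0 :> nat) && (n == 0 :> nat) then 1
    else if (m == k.-1 :> nat) && (n == k.-1 :> nat) then c
    else 0.

(* Main.v *)
Require Import Defs.
From mathcomp Require Import all_boot all_order all_algebra.
From mathcomp Require Import ring.
Set Implicit Arguments.
Unset Strict Implicit.
Unset Printing Implicit Defensive.
Import Order.TTheory GRing.Theory Num.Theory.
Local Open Scope ring_scope.

(** Both off-diagonals of [z%:M - matA1 C k alpha beta] are constant, and such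
    a tridiagonal determinant depends on them only through their product [p].
    Expanding along the first row gives the three-term recurrence
    [D (n+2) = a * D (n+1) - p * D n], where [a] is the first diagonal entry.
    If [p = s ^+ 2] and the diagonal is constantly [2 * s * x], this is the
    recurrence of [U_n] rescaled by [s ^+ n], so the determinant of size [n] is
    [P n = s ^+ n * U_n(x)].

    The corners of [matA1] lower the first diagonal entry by [h] and the last
    one by [g].  The change at the bottom only alters the initial values of the
    recurrence ([det_tridiag_last]), and the change at the top only its last step,
    whence
      [P k - (h + g) * P (k-1) + h * g * P (k-2)]
    ([det_tridiag_corners]).  Here [h = 1], [g = c = (-1) ^+ (beta + 1)] and
    [p = c * d = (-1) ^+ (alpha + 1)], so that [s = 'i] for [alpha = 0] and
    [s = 1] for [alpha = 1].  The four formulas follow by simplifying with the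
    recurrence of [U] and with [2 T_n = U_n - U_(n-2)].  *)

(** * Chebyshev polynomials *)

Section Chebyshev.
Variables (R : comNzRingType) (x : R).

Lemma horner_chebT0 : (chebT R 0).[x] = 1.
Proof. exact: hornerC. Qed.

Lemma horner_chebT1 : (chebT R 1).[x] = x.
Proof. exact: hornerX. Qed.

Lemma horner_chebT_rec n :
  (chebT R n.+2).[x] = 2%:R * x * (chebT R n.+1).[x] - (chebT R n).[x].
Proof. by rewrite [chebT R n.+2]/= !hornerE. Qed.

Lemma horner_chebU0 : (chebU R 0).[x] = 1.
Proof. exact: hornerC. Qed.

Lemma horner_chebU1 : (chebU R 1).[x] = 2%:R * x.
Proof. by rewrite hornerZ hornerX. Qed.

Lemma horner_chebU_rec n :
  (chebU R n.+2).[x] = 2%:R * x * (chebU R n.+1).[x] - (chebU R n).[x].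
Proof. by rewrite [chebU R n.+2]/= !hornerE. Qed.

(** Both sides satisfy the common recurrence of [T] and [U], so that it is
    enough to compare two consecutive values. *)
Lemma double_chebT n :
  2%:R * (chebT R n.+2).[x] = (chebU R n.+2).[x] - (chebU R n).[x].
Proof.
suff [] : 2%:R * (chebT R n.+2).[x] = (chebU R n.+2).[x] - (chebU R n).[x] /\
  2%:R * (chebT R n.+3).[x] = (chebU R n.+3).[x] - (chebU R n.+1).[x] by [].
elim: n => [|n [IH1 IH2]].
  rewrite !horner_chebT_rec !horner_chebU_rec.
  by rewrite horner_chebT1 horner_chebT0 horner_chebU1; split; ring.
split=> //.
rewrite horner_chebT_rec (horner_chebU_rec n.+2).
have -> : 2%:R * (2%:R * x * (chebT R n.+3).[x] - (chebT R n.+2).[x]) =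
  2%:R * x * (2%:R * (chebT R n.+3).[x]) - 2%:R * (chebT R n.+2).[x] by ring.
by rewrite IH1 IH2 (horner_chebU_rec n); ring.
Qed.

End Chebyshev.

(** * Tridiagonal determinants *)

Section Tridiagonal.
Variable R : comNzRingType.

(** The diagonal is a function on [nat], so that one function serves all sizes
    and removing the first row and column is a shift of the argument. *)
Definition tridiag n (a : nat -> R) (b c : R) : 'M[R]_n :=
  \matrix_(i, j) if j == i.+1 :> nat then b
                 else if i == j.+1 :> nat then c
                 else if i == j :> nat then a i else 0.

Lemma eq_tridiag n (a a' : nat -> R) b c :
  (forall i, (i < n)%N -> a i = a' i) -> tridiag n a b c = tridiag n a' b c.
Proof. by move=> eq_a; apply/matrixP=> i j; rewrite !mxE eq_a. Qed.

Lemma det_tridiag1 a b c : \det (tridiag 1 a b c) = a 0.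
Proof. by rewrite det_mx11 mxE. Qed.

Lemma det_tridiag_rec n a b c :
  \det (tridiag n.+2 a b c) =
    a 0 * \det (tridiag n.+1 (fun i => a i.+1) b c)
    - b * c * \det (tridiag n (fun i => a i.+2) b c).
Proof.
rewrite (expand_det_row _ ord0) !big_ord_recl big1 => [|j _]; last first.
  by rewrite mxE /= mul0r.
rewrite addr0 !mxE /= /cofactor /= expr0 expr1 mul1r mulN1r mulrN -mulrA.
congr (_ * \det _ - _ * _).
  by apply/matrixP=> i j; rewrite !mxE /= !eqSS.
(* Removing row 0 and column 1 leaves a first column whose only nonzero entry
   is the subdiagonal [c] at its top. *)
rewrite (expand_det_col _ ord0) big_ord_recl big1 => [|i _]; last first.
  by rewrite !mxE /= mul0r.
rewrite addr0 !mxE /= /cofactor /= expr0 mul1r; congr (_ * \det _).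
by apply/matrixP=> i j; rewrite !mxE /= !eqSS.
Qed.

Variables (s x b c : R).
Hypothesis bcE : b * c = s ^+ 2.

(** The recurrence peels entries off the top, so lowering the last diagonal
    entry keeps it and only changes the initial value at size 1.  The right-hand
    side is [P (n+1) - g * P n]. *)
Lemma det_tridiag_last g n :
  \det (tridiag n.+1 (fun i => 2%:R * s * x - g *+ (i == n)) b c) =
    s ^+ n.+1 * (chebU R n.+1).[x] - g * s ^+ n * (chebU R n).[x].
Proof.
pose D n := \det (tridiag n (fun i => 2%:R * s * x - g *+ (i.+1 == n)) b c).
have D1 : D 1%N = 2%:R * s * x - g by rewrite /D det_tridiag1.
have Drec m : D m.+2 = 2%:R * s * x * D m.+1 - s ^+ 2 * D m.
  by rewrite /D det_tridiag_rec bcE /= subr0.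
suff [] : D n.+1 = s ^+ n.+1 * (chebU R n.+1).[x] - g * s ^+ n * (chebU R n).[x]
  /\ D n.+2 = s ^+ n.+2 * (chebU R n.+2).[x] - g * s ^+ n.+1 * (chebU R n.+1).[x].
  by [].
elim: n => [|n [IH1 IH2]].
  rewrite Drec D1 [D 0]det_mx00 horner_chebU_rec horner_chebU1 horner_chebU0.
  by split; ring.
split=> //.
rewrite Drec IH1 IH2 (horner_chebU_rec x n.+1) (horner_chebU_rec x n) !exprS.
by ring.
Qed.

Lemma det_tridiag_corners h g n :
  \det (tridiag n.+2
     (fun i => 2%:R * s * x - h *+ (i == 0) - g *+ (i == n.+1)) b c) =
    s ^+ n.+2 * (chebU R n.+2).[x] - (h + g) * s ^+ n.+1 * (chebU R n.+1).[x]
    + h * g * s ^+ n * (chebU R n).[x].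
Proof.
rewrite det_tridiag_rec bcE mulr1n mulr0n subr0.
under eq_tridiag => i _ do rewrite mulr0n subr0 eqSS.
rewrite det_tridiag_last.
(* The second remaining block is empty when [n = 0], so it has no last entry to
   lower; its determinant 1 is the value that the recurrence needs. *)
case: n => [|n].
  by rewrite det_mx00 horner_chebU_rec horner_chebU1 horner_chebU0; ring.
under [X in _ - _ * \det X]eq_tridiag => i _ do rewrite mulr0n subr0 !eqSS.
rewrite det_tridiag_last.
by rewrite (horner_chebU_rec x n.+1) (horner_chebU_rec x n) !exprS; ring.
Qed.

End Tridiagonal.

(** * The characteristic matrices *)

(** The size is at least 2: then the two corners are distinct, and each gets
    its own correction. *)
Lemma char_matA1 (R : comNzRingType) n alpha beta (z : R) :
  let c : R := (-1) ^+ (beta + 1) in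
  let d : R := (-1) ^+ (alpha + beta) in
  z%:M - matA1 R n.+2 alpha beta =
    tridiag n.+2 (fun i => z - 1 *+ (i == 0) - c *+ (i == n.+1)) (- d) (- c).
Proof.
move=> c d; apply/matrixP=> i j; rewrite !mxE -/c -/d -val_eqE /=.
case: (eqVneq (j : nat) i.+1) => [->|_].
  by rewrite ltn_eqF // sub0r.
case: (eqVneq (i : nat) j.+1) => [->|_].
  by rewrite gtn_eqF // sub0r.
case: (eqVneq (i : nat) j) => [->|ne_ij].
  by case: (nat_of_ord j) => [|m] //=; rewrite ?andbb; [|case: ifP];
    rewrite ?mulr1n ?mulr0n ?subr0.
do 2![case: ifP => [/andP[/eqP i0 /eqP j0]|_];
  first by rewrite i0 j0 eqxx in ne_ij].
by rewrite subr0.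
Qed.

(** [c * d = (-1) ^+ (alpha + 1)] because [beta] enters both exponents. *)
Lemma det_char_matA1 (R : comNzRingType) n alpha beta (s x : R) :
  s ^+ 2 = (-1) ^+ (alpha + 1) ->
  let c : R := (-1) ^+ (beta + 1) in
  \det ((2%:R * s * x)%:M - matA1 R n.+2 alpha beta) =
    s ^+ n.+2 * (chebU R n.+2).[x] - (1 + c) * s ^+ n.+1 * (chebU R n.+1).[x]
    + c * s ^+ n * (chebU R n).[x].
Proof.
move=> s2 c; rewrite char_matA1 (det_tridiag_corners (s := s)) ?mul1r //.
by rewrite mulrNN s2 !exprD !expr1 -mulrA (mulrA _ _ (-1)) -expr2 sqrr_sign mul1r.
Qed.

Theorem theorem1 (C : numClosedFieldType) (k : nat) (hk : (2 <= k)%N) (z : C) :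
  [/\ \det (z%:M - matA1 C k 0 0)
        = 'i ^+ (k - 1) * z * (chebU C (k - 1)).[z / (2%:R * 'i)],
      \det (z%:M - matA1 C k 0 1)
        = 2%:R * 'i ^+ k * (chebT C k).[z / (2%:R * 'i)]
          - 2%:R * 'i ^+ (k - 1) * (chebU C (k - 1)).[z / (2%:R * 'i)],
      \det (z%:M - matA1 C k 1 0)
        = 2%:R * (chebT C k).[z / 2%:R]
    & \det (z%:M - matA1 C k 1 1)
        = (z - 2%:R) * (chebU C (k - 1)).[z / 2%:R] ].
Proof.
case: k hk => [|[|n]] // _; rewrite subn1 [n.+2.-1]/=.
have nz2 : 2%:R != 0 :> C by rewrite pnatr_eq0.
set y := z / (2%:R * 'i); set w := z / 2%:R.
have zy : z = 2%:R * 'i * y.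
  by rewrite /y mulrC divfK // mulf_neq0 // neq0Ci.
have zw : z = 2%:R * 1 * w by rewrite /w mulr1 mulrC divfK.
have alpha0 : 'i ^+ 2 = (-1) ^+ (0 + 1) :> C by rewrite sqrCi.
have alpha1 : 1 ^+ 2 = (-1) ^+ (1 + 1) :> C by rewrite expr1n sqrrN expr1n.
have ii : 'i * 'i = -1 :> C by rewrite -expr2 sqrCi.
have Ui m : 'i ^+ m.+2 * (chebU C m.+2).[y] =
    z * ('i ^+ m.+1 * (chebU C m.+1).[y]) + 'i ^+ m * (chebU C m).[y].
  by rewrite horner_chebU_rec zy !exprS; ring: ii.
have Ti m : 2%:R * 'i ^+ m.+2 * (chebT C m.+2).[y] =
    'i ^+ m.+2 * (chebU C m.+2).[y] + 'i ^+ m * (chebU C m).[y].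
  by rewrite mulrAC double_chebT !exprS; ring: ii.
split.
- by rewrite [in LHS]zy det_char_matA1 // Ui expr1; ring.
- by rewrite [in LHS]zy det_char_matA1 // sqrrN expr1n Ti; ring.
- by rewrite [in LHS]zw det_char_matA1 // !expr1n double_chebT expr1; ring.
- rewrite [in LHS]zw det_char_matA1 // !expr1n horner_chebU_rec sqrrN expr1n.
  by rewrite [in RHS]zw; ring.
Qed.
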